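(* Let $X_t=\mu t+\sigma B_t$ be a linear Brownian motion with $\mu\in\mathbb R$, $\sigma>0$, and let $q,\delta,r>0$. The function $V^{(q)}$ has the following form. For $x\ge0$, $$V^{(q)}(x)=\frac{\sigma^2}{2}\mathbb W^{(q)}(x)\Big[\frac{2}{\sqrt{2\pi\sigma^2r}}e^{-\frac{r\mu^2}{2\sigma^2}}+\rho_2e^{qr}-\rho e^{qr}\Phi\Big(\frac{-r\sqrt{\mu^2+2q\sigma^2}}{\sigma\sqrt r}\Big)\Big]+\frac{e^{qr}}{\rho^Y}\Big(\rho_1^Ye^{\rho_2^Yx}+\rho_2^Ye^{-\rho_1^Yx}\Big).$$ For $x<0$, $$V^{(q)}(x)=e^{qr}\Big(e^{\rho_2x}\Big[1-\Phi\Big(\frac{-x-r\sqrt{\mu^2+2q\sigma^2}}{\sigma\sqrt r}\Big)\Big]+e^{-\rho_1x}\Big[1-\Phi\Big(\frac{-x+r\sqrt{\mu^2+2q\sigma^2}}{\sigma\sqrt r}\Big)\Big]\Big).$$ Here $\Phi$ is the cumulative distribution function of the standard normal distribution.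
   Context: $B$ is a standard Brownian motion under $\mathbb P$ and $X_0=0$ under $\mathbb P$. Set $\rho_1=\frac{\sqrt{\mu^2+2q\sigma^2}+\mu}{\sigma^2}$, $\rho_2=\frac{\sqrt{\mu^2+2q\sigma^2}-\mu}{\sigma^2}$, $\rho=\rho_1+\rho_2$, and $\rho_1^Y=\frac{\sqrt{(\mu-\delta)^2+2q\sigma^2}+(\mu-\delta)}{\sigma^2}$, $\rho_2^Y=\frac{\sqrt{(\mu-\delta)^2+2q\sigma^2}-(\mu-\delta)}{\sigma^2}$, $\rho^Y=\rho_1^Y+\rho_2^Y$. The $q$-scale functions of $X$ and of $Y_t=X_t-\delta t$ are, for $x\ge0$, $W^{(q)}(x)=\frac{2}{\sigma^2\rho}(e^{\rho_2x}-e^{-\rho_1x})$ and $\mathbb W^{(q)}(x)=\frac{2}{\sigma^2\rho^Y}(e^{\rho_2^Yx}-e^{-\rho_1^Yx})$, and both vanish for $x<0$. For $x,a\in\mathbb R$, $w^{(q)}(x;a)=W^{(q)}(x-a)$ if $x<0$ and $w^{(q)}(x;a)=W^{(q)}(x-a)+\delta\int_0^x\mathbb W^{(q)}(x-y)W^{(q)\prime}(y-a)dy$ if $x\ge0$. The Parisian refracted scale function is $V^{(q)}(x)=\int_0^\infty w^{(q)}(x;-z)\frac zr\mathbb P(X_r\in dz)$. *)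

(* Defs.v *)
From HB Require Import structures.
From mathcomp Require Import all_boot all_order all_algebra.
From mathcomp Require Import all_classical all_reals all_analysis.

Set Implicit Arguments.
Unset Strict Implicit.
Unset Printing Implicit Defensive.

Import Order.TTheory GRing.Theory Num.Theory.
Import numFieldNormedType.Exports.

Local Open Scope classical_set_scope.
Local Open Scope ring_scope.

(* Time is indexed by all of R, but only times t >= 0 are constrained. A finite
   partition t 0 <= ... <= t n is a nondecreasing sequence of which only the
   first n increments are used. Since the sets A i are arbitrary (setT
   included), the product rule is mutual independence of the increments. *)
Record standard_brownian_motion (d : measure_display) (T : measurableType d)
    (R : realType) (P : probability T R) (B : R -> {RV P >-> R}) : Prop := {
  sbm_start : {ae P, forall w, B 0 w = 0};
  sbm_indep : forall (n : nat) (t : nat -> R) (A : nat -> set R),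
    0 <= t 0%N -> nondecreasing_seq t -> (forall i, measurable (A i)) ->
    P [set w | forall i, (i < n)%N -> A i (B (t i.+1) w - B (t i) w)] =
    (\prod_(i < n) P [set w | A i (B (t i.+1) w - B (t i) w)%R])%E;
  sbm_gauss : forall (s t : R) (A : set R), 0 <= s -> s < t -> measurable A ->
    P [set w | A (B t w - B s w)] = normal_prob 0 (Num.sqrt (t - s)) A;
  sbm_cont : {ae P, forall w, {within `[0, +oo[, continuous (B^~ w)}}
}.

Section ScaleFunctions.
Context {R : realType}.

(* For a linear Brownian motion with drift m and volatility sigma; the
   quantities attached to Y are those with drift m := mu - delta. *)
Definition rho1 (m sigma q : R) : R :=
  (Num.sqrt (m ^+ 2 + 2 * q * sigma ^+ 2) + m) / sigma ^+ 2.

Definition rho2 (m sigma q : R) : R :=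
  (Num.sqrt (m ^+ 2 + 2 * q * sigma ^+ 2) - m) / sigma ^+ 2.

Definition rho (m sigma q : R) : R := rho1 m sigma q + rho2 m sigma q.

(* The q-scale function of t |-> m * t + sigma * B_t. *)
Definition scaleW (m sigma q x : R) : R :=
  if x < 0 then 0
  else 2 / (sigma ^+ 2 * rho m sigma q) *
       (expR (rho2 m sigma q * x) - expR (- rho1 m sigma q * x)).

(* w^(q)(x; a). The derivative of scaleW is a junk value at 0, where scaleW has
   a kink; this affects a single point of the integration domain. *)
Definition refracted_w (mu sigma delta q x a : R) : R :=
  if x < 0 then scaleW mu sigma q (x - a)
  else scaleW mu sigma q (x - a) +
       delta * \int[lebesgue_measure]_(y in `[0, x])
         (scaleW (mu - delta) sigma q (x - y) *
          (scaleW mu sigma q)^`()%classic (y - a)).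

(* V^(q)(x), with Xr the value of the process at time r. Extended-real-valued:
   an equation V^(q)(x) = c%:E also says that the integral converges. *)
Definition parisian_V (d : measure_display) (T : measurableType d)
    (P : probability T R) (Xr : {RV P >-> R})
    (mu sigma delta q r x : R) : \bar R :=
  (\int[distribution P Xr]_(z in `[0%R, +oo[)
     (refracted_w mu sigma delta q x (- z) * (z / r))%:E)%E.

(* The standard normal cumulative distribution function. *)
Definition Phi (x : R) : R := fine (normal_prob 0 1 `]-oo, x]).

End ScaleFunctions.

(* Main.v *)
(* Under the law of X_r, tilting by [expR (rho2 * z)] or [expR (- rho1 * z)]
   turns the Gaussian of mean [mu * r] into [expR (q * r)] times a Gaussian of
   mean [r * s] or [- (r * s)], because [rho2] and [- rho1] are the roots of
   psi_X = q. For x < 0 the scale function is a combination of these two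
   exponentials. For x >= 0 so is z |-> w^(q)(x; - z): the convolution of the
   scale function of Y with [expR (l * y)], for a root [l], cancels the
   [expR (l * x)] term since psi_Y(l) - q = - delta * l. What remains is the
   first moment of a Gaussian restricted to a half-line. *)

Require Import Defs.
From HB Require Import structures.
From mathcomp Require Import all_boot all_order all_algebra.
From mathcomp Require Import all_classical all_reals all_analysis.
From mathcomp Require Import measurable_realfun ring.

Set Implicit Arguments.
Unset Strict Implicit.
Unset Printing Implicit Defensive.

Import Order.TTheory GRing.Theory Num.Theory.
Import numFieldNormedType.Exports.

Local Open Scope classical_set_scope.
Local Open Scope ring_scope.

(** * Integration against a normal law *)

Lemma ge0_integral_normal_prob {R : realType} (m s : R) (D : set R)
    (f : R -> \bar R) : measurable D -> measurable_fun D f ->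
  (forall x, D x -> 0 <= f x)%E ->
  (\int[normal_prob m s]_(x in D) f x =
   \int[lebesgue_measure]_(x in D) (f x * (normal_pdf m s x)%:E))%E.
Proof.
move=> mD mf f0.
have dom := normal_prob_dominates m s.
pose g := f \_ D.
have mg : measurable_fun setT g by apply/(measurable_restrictT _ mD).
have g0 x : (0 <= g x)%E.
  by rewrite /g patchE; case: ifPn => // /set_mem; exact: f0.
have mpdf : measurable_fun setT (fun x => (normal_pdf m s x)%:E).
  by apply/measurable_EFinP; exact: measurable_normal_pdf.
transitivity (\int[normal_prob m s]_x g x)%E; first by rewrite -integral_mkcond.
rewrite -(Radon_Nikodym_SigmaFinite.change_of_variables dom g0 measurableT mg).
transitivity (\int[lebesgue_measure]_x (g x * (normal_pdf m s x)%:E))%E; last first.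
  rewrite [RHS]integral_mkcond; apply: eq_integral => x _.
  by rewrite /g !patchE; case: ifPn => // _; rewrite mul0e.
have RNint := Radon_Nikodym_SigmaFinite.f_integrable dom.
apply: ae_eq_integral => //.
- by apply: emeasurable_funM => //; exact: measurable_int RNint.
- exact: emeasurable_funM.
(* The Radon-Nikodym derivative and the Gaussian density have the same integral over every
   measurable set, hence agree almost everywhere. *)
- apply: ae_eqe_mul2l; apply: integral_ae_eq => // E _ mE.
  by rewrite -Radon_Nikodym_SigmaFinite.f_integral.
Qed.

(** * The standard normal distribution function: derivative, symmetry, limit *)

Section normal_cdf.
Context {R : realType}.
Implicit Types (m s x : R).

(** Seen as a random variable under the standard normal law, the identity has [Phi] as its
    distribution function, which brings in the general limit theorem for such functions. *)
Let idTR : measurableTypeR R -> R := idfun.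

#[local] HB.instance Definition _ :=
  @isMeasurableFun.Build _ _ _ _ idTR (@measurable_id _ _ setT).

Lemma is_derive_Phi x : is_derive x 1 (@Phi R) (normal_pdf 0 1 x).
Proof.
have ipdf y : lebesgue_measure.-integrable `]-oo, y] (EFin \o normal_pdf (0 : R) 1).
  by apply: (integrableS _ _ (@subsetT _ _)) => //; exact: integrable_normal_pdf.
have cpdf : {for x, continuous (normal_pdf (0 : R) 1)}.
  by apply: continuous_normal_pdf; rewrite oner_eq0.
have xx1 : x < x + 1 by rewrite ltrDl.
have [dPhi Phi'] := continuous_FTC1 xx1 (ipdf _) (ltNyr _) cpdf.
have -> : @Phi R = fun y =>
    \int[lebesgue_measure]_(t in `]-oo, y]) normal_pdf 0 1 t by apply/funext.
apply: (DeriveDef dPhi).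
by rewrite -derive1E Phi'.
Qed.

(** The density is even, so t |-> - t carries the left tail to a right tail; the endpoint has no
    mass, and the complement of the right tail is []-oo, x]]. *)
Lemma PhiN x : Phi (- x) = 1 - Phi x :> R.
Proof.
have cpdf : continuous (@normal_pdf R 0 1).
  by apply: continuous_normal_pdf; rewrite oner_eq0.
have Eopp : normal_prob 0 1 `]-oo, (- x)%R] = normal_prob 0 1 `[x, +oo[ :> \bar R.
  have := @ge0_integration_by_substitutionNy R (normal_pdf 0 1) x.
  rewrite /normal_prob => ->.
  - apply: eq_integral => t _ /=; congr EFin.
    by rewrite normal_pdfE ?oner_eq0// /normal_fun !subr0 sqrrN.
  - exact: continuous_subspaceT.
  - by move=> t _; exact: normal_pdf_ge0.
have Ec : normal_prob 0 1 `[x, +oo[ = normal_prob 0 1 `]x, +oo[ :> \bar R.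
  rewrite /normal_prob -integral_itv_obnd_cbnd//.
  by apply/measurable_funTS/measurable_EFinP; exact: measurable_normal_pdf.
rewrite /Phi Eopp Ec -setCitvl probability_setC// fineB//.
by rewrite fin_num_measure.
Qed.

Lemma cvg_Phiy : Phi x @[x --> +oo] --> (1 : R).
Proof.
exact/fine_cvg/(cvg_cdfy1 (idTR : {RV (normal_prob 0 1) >-> R})).
Qed.
End normal_cdf.

(** * First moment of a Gaussian restricted to a half-line *)

Section normal_moment.
Context {R : realType}.
Implicit Types (m s x : R).

Lemma normal_pdf_standardize m s x : 0 < s ->
  normal_pdf m s x = normal_pdf 0 1 ((x - m) / s) / s.
Proof.
move=> s0; have sn0 : s != 0 by rewrite gt_eqF.
rewrite !normal_pdfE ?oner_eq0// /normal_peak /normal_fun.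
rewrite subr0 expr1n mul1r -mulrnAr sqrtrM ?sqr_ge0// sqrtr_sqr gtr0_norm//.
rewrite invfM -mulrA [RHS]mulrC; congr (_ * (_ * expR _)).
by field.
Qed.

Lemma is_derive_normal_pdf m s x : 0 < s ->
  is_derive x 1 (normal_pdf m s) (- ((x - m) / s ^+ 2) * normal_pdf m s x).
Proof.
move=> s0; have sn0 : s != 0 by rewrite gt_eqF.
have din : is_derive x 1 (fun y => - (y - m) ^+ 2 / (s ^+ 2 *+ 2))
    (- ((x - m) / s ^+ 2)).
  by apply: is_derive_eq; rewrite /GRing.scale /=; field.
have dexp := is_derive1_comp (is_derive_expR _) din.
have -> : normal_pdf m s = normal_peak s *:
    (expR \o (fun y => - (y - m) ^+ 2 / (s ^+ 2 *+ 2))).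
  by rewrite normal_pdfE.
apply: (is_derive_eq (is_deriveZ _ dexp)).
rewrite !fctE /GRing.scale /=.
by ring.
Qed.

Lemma is_derive_Phi_center m s x : 0 < s ->
  is_derive x 1 (fun y => Phi ((y - m) / s)) (normal_pdf m s x).
Proof.
move=> s0; rewrite normal_pdf_standardize//.
have dlin : is_derive x 1 (fun y => (y - m) / s) (s^-1).
  by apply: is_derive_eq; rewrite /GRing.scale /=; ring.
exact: (is_derive1_comp (is_derive_Phi _) dlin).
Qed.

Lemma cvg_center_y m s : 0 < s -> (x - m) / s @[x --> +oo] --> +oo.
Proof.
by move=> s0; apply/gt0_cvgMly; [rewrite invr_gt0|exact: cvg_addrr].
Qed.

Lemma cvg_normal_pdfy m s : 0 < s -> normal_pdf m s x @[x --> +oo] --> 0.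
Proof.
move=> s0; rewrite normal_pdfE ?gt_eqF//.
rewrite -[X in _ --> X](mulr0 (normal_peak s)); apply: cvgM; first exact: cvg_cst.
(* The exponential is exp(- y ^ 2) at y = (x - m) / (sqrt 2 * s), so the known limit of [gauss_fun]
   applies. *)
have -> : normal_fun m s = gauss_fun \o (fun x => (x - m) / (Num.sqrt 2 * s)).
  apply/funext => x; rewrite /normal_fun /gauss_fun /= expr_div_n exprMn.
  by rewrite sqr_sqrtr// mulr_natl mulNr.
apply: cvg_comp cvg_gauss_fun; apply: cvg_center_y.
by rewrite mulr_gt0// sqrtr_gt0.
Qed.

(** The sign conditions on [b] and [a + b * c] make the integrand nonnegative on the half-line, as
    the improper fundamental theorem of calculus requires. *)
Lemma integral_normal_pdf_linear m s c a b : 0 < s -> 0 <= b ->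
  0 <= a + b * c ->
  (\int[lebesgue_measure]_(x in `[c, +oo[)
     ((a + b * x) * normal_pdf m s x)%:E =
   ((a + b * m) * (1 - Phi ((c - m) / s))
    + b * s ^+ 2 * normal_pdf m s c)%:E)%E.
Proof.
move=> s0 b0 abc.
(* Write a + b * x = (a + b * m) + b * (x - m): the first part integrates to [Phi], the second to
   the density itself, whose derivative is - (x - m) / s ^ 2 times it. *)
pose F y := (a + b * m) * Phi ((y - m) / s) - b * s ^+ 2 * normal_pdf m s y.
have dF x : is_derive x 1 F ((a + b * x) * normal_pdf m s x).
  have ? := is_derive_Phi_center m x s0; have ? := is_derive_normal_pdf m x s0.
  rewrite /F; apply: is_derive_eq; rewrite /GRing.scale /=.
  by field; rewrite gt_eqF.
have cF x : {for x, continuous F}.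
  by apply/differentiable_continuous/derivable1_diffP; case: (dF x).
rewrite (@ge0_continuous_FTC2y _ _ F _ (a + b * m)).
- by rewrite -EFinB; congr EFin; rewrite /F; ring.
- move=> x cx; rewrite mulr_ge0 ?normal_pdf_ge0//.
  by rewrite (le_trans abc)// lerD2l ler_wpM2l.
- apply: continuous_subspaceT => x; apply: cvgM.
    by apply: cvgD; [exact: cvg_cst|apply: cvgM; [exact: cvg_cst|exact: cvg_id]].
  by apply: continuous_normal_pdf; rewrite gt_eqF.
- rewrite -[X in _ --> X]subr0 -[X in _ --> X - _]mulr1 -(mulr0 (b * s ^+ 2)).
  apply: cvgB; apply: cvgM; [exact: cvg_cst| |exact: cvg_cst|].
    by apply: cvg_comp cvg_Phiy; exact: cvg_center_y.
  exact: cvg_normal_pdfy.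
- by move=> x _; case: (dF x).
- exact/cvg_at_right_filter/cF.
- by move=> x _; rewrite derive1E; case: (dF x).
Qed.
End normal_moment.

(** * The law of X_r and its exponential tilting *)

Section drifted_brownian_motion.
Context (d : measure_display) (T : measurableType d) (R : realType)
  (P : probability T R) (B X : R -> {RV P >-> R}) (mu sigma r : R).

Lemma ge0_integral_drifted_bm (F : R -> \bar R) :
  standard_brownian_motion B ->
  (forall w, X r w = mu * r + sigma * B r w) -> 0 < r ->
  measurable_fun [set: R] F -> (forall z, 0 <= F z)%E ->
  (\int[distribution P (X r)]_z F z = \int[lebesgue_measure]_b
     (F (mu * r + sigma * b)%R * (normal_pdf 0 (Num.sqrt r) b)%:E))%E.
Proof.
move=> hB hX r0 mF F0.
(* Gaussianity is assumed of increments and [B 0 = 0] only almost surely, so the law is read off the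
   increment from 0 to [r]. *)
pose D0 : T -> measurableTypeR R := (B r \- B 0)%R.
have mD0 : measurable_fun setT D0 by exact: measurable_funB.
pose D : {RV P >-> measurableTypeR R} :=
  HB.pack D0 (isMeasurableFun.Build _ _ _ _ D0 mD0).
have maff : measurable_fun [set: R] (fun b : R => mu * r + sigma * b : R).
  apply: continuous_measurable_fun => b; apply: cvgD; first exact: cvg_cst.
  by apply: cvgM; [exact: cvg_cst|exact: cvg_id].
have mG : measurable_fun [set: R] (fun b : R => F (mu * r + sigma * b)).
  exact: (measurableT_comp mF maff).
have mGD : measurable_fun setT (fun w => F (mu * r + sigma * D w)).
  exact: (measurableT_comp mG (measurable_funPT D)).
rewrite ge0_integral_distribution//.
transitivity (\int[P]_w F (mu * r + sigma * D w)%R)%E.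
  apply: ge0_ae_eq_integral => //; [exact: measurableT_comp|by move=> w _ /=|].
  have := sbm_start hB; apply: filterS => w B0w _ /=.
  by rewrite hX /= /D0 /= B0w subr0.
transitivity (\int[distribution P D]_b F (mu * r + sigma * b)%R)%E.
  by rewrite ge0_integral_distribution.
rewrite -ge0_integral_normal_prob//.
apply: eq_measure_integral => A mA _.
by have := sbm_gauss hB (lexx 0) r0 mA; rewrite subr0.
Qed.

(** Completing the square in [b]. The prefactor is exp(r * psi_X(lam)), with psi_X the Laplace
    exponent. *)
Lemma normal_pdf_tilt (lam b : R) : 0 < r ->
  expR (lam * (mu * r + sigma * b)) * normal_pdf 0 (Num.sqrt r) b =
  expR ((mu * lam + sigma ^+ 2 * lam ^+ 2 / 2) * r) *
    normal_pdf (lam * sigma * r) (Num.sqrt r) b.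
Proof.
move=> r0; have sr0 : Num.sqrt r != 0 by rewrite gt_eqF// sqrtr_gt0.
rewrite !normal_pdfE// /normal_fun mulrCA [RHS]mulrCA -!expRD.
rewrite sqr_sqrtr ?ltW//; congr (_ * expR _).
by field; rewrite gt_eqF.
Qed.

(** In the Brownian variable, the tilted integrand is an affine function times a shifted Gaussian
    density, so the half-line moment formula applies. *)
Lemma integral_drifted_bm_tilted (lam zeta : R) :
  standard_brownian_motion B ->
  (forall w, X r w = mu * r + sigma * B r w) -> 0 < r -> 0 < sigma ->
  0 <= zeta ->
  (\int[distribution P (X r)]_(z in `[zeta, +oo[) (expR (lam * z) * z)%:E =
   (expR ((mu * lam + sigma ^+ 2 * lam ^+ 2 / 2) * r) *
      ((mu + lam * sigma ^+ 2) * r) *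
      (1 - Phi ((zeta - (mu + lam * sigma ^+ 2) * r) / (sigma * Num.sqrt r))) +
    sigma * r * expR (lam * zeta) *
      normal_pdf 0 (Num.sqrt r) ((zeta - mu * r) / sigma))%:E)%E.
Proof.
move=> hB hX r0 sigma0 zeta0.
have sr0 : 0 < Num.sqrt r by rewrite sqrtr_gt0.
(* [c] is the Brownian value at which X_r reaches [zeta]. *)
set M := expR ((_ + _) * r); set c := (zeta - mu * r) / sigma.
have sn0 : sigma != 0 by rewrite gt_eqF.
have cE : mu * r + sigma * c = zeta by rewrite /c; field.
rewrite integral_mkcond ge0_integral_drifted_bm//; last 2 first.
- apply/(measurable_restrictT _ _).1 => //; apply/measurable_EFinP.
  by apply: measurable_funM => //; apply: measurableT_comp => //;
    exact: measurable_funM.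
- move=> z; rewrite patchE; case: ifPn => // /set_mem /=.
  rewrite in_itv/= andbT => zetaz.
  by rewrite lee_fin mulr_ge0 ?expR_ge0// (le_trans zeta0).
transitivity (\int[lebesgue_measure]_(b in `[c, +oo[)
    ((M * mu * r + M * sigma * b) *
     normal_pdf (lam * sigma * r) (Num.sqrt r) b)%:E)%E.
  rewrite [RHS]integral_mkcond; apply: eq_integral => b _.
  have zb : (zeta <= mu * r + sigma * b) = (c <= b).
    by rewrite -cE lerD2l ler_pM2l.
  rewrite !patchE !mem_setE /= !in_itv /= !andbT zb.
  case: ifPn => _; last by rewrite mul0e.
  rewrite -EFinM; congr EFin; rewrite mulrAC normal_pdf_tilt// -/M.
  by ring.
rewrite integral_normal_pdf_linear//; last 2 first.
- by rewrite mulr_ge0 ?expR_ge0 ?ltW.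
- by rewrite -!mulrA -mulrDr cE mulr_ge0 ?expR_ge0.
congr EFin; congr (_ * _ + _).
- by ring.
- by congr (1 - Phi _); rewrite /c; field; rewrite sn0 gt_eqF.
(* The boundary term carries the shifted density at [c]; tilting back gives the centred density
   times [expR (lam * zeta)]. *)
- rewrite sqr_sqrtr ?ltW// -[in RHS]cE.
  have := normal_pdf_tilt lam c r0; rewrite -/M => tilt.
  by rewrite -[RHS]mulrA tilt; ring.
Qed.

End drifted_brownian_motion.

(** * Convolution of exponentials *)

Section refraction.
Context {R : realType}.
Implicit Types (a b k l p x y : R).

Lemma Rintegral_continuous_FTC2 (f F : R -> R) a b : a <= b ->
  continuous f -> (forall x, is_derive x 1 F (f x)) ->
  \int[lebesgue_measure]_(x in `[a, b]) f x = F b - F a.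
Proof.
move=> ab cf dF.
have cF x : {for x, continuous F}.
  by apply/differentiable_continuous/derivable1_diffP; case: (dF x).
move: ab; rewrite le_eqVlt => /predU1P[<-|ab].
  by rewrite set_itv1 Rintegral_set1 subrr.
rewrite /Rintegral (continuous_FTC2 ab (F := F)) -?EFinB//.
- exact: continuous_subspaceT.
- split; [by move=> x _; case: (dF x)| |].
  + exact/cvg_at_right_filter/cF.
  + exact/cvg_at_left_filter/cF.
- by move=> x _; rewrite derive1E; case: (dF x).
Qed.

Lemma is_derive_expR_affine p c x :
  is_derive x 1 (fun y => expR (p + c * y)) (c * expR (p + c * x)).
Proof.
have dlin : is_derive x 1 (fun y => p + c * y) c.
  by apply: is_derive_eq; rewrite /GRing.scale /=; ring.
rewrite mulrC.
exact: (is_derive1_comp (is_derive_expR _) dlin).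
Qed.

(* To be read with [b] and [- a] the roots of psi_Y = q, [l1] and [l2] those of
   psi_X = q, and [k = 2 * delta / sigma ^+ 2]. *)
Lemma refracted_convolution a b k c1 l1 c2 l2 x : 0 <= x -> k != 0 ->
  (l1 - b) * (l1 + a) = - (k * l1) -> (l2 - b) * (l2 + a) = - (k * l2) ->
  k * \int[lebesgue_measure]_(y in `[0, x])
    ((expR (b * (x - y)) - expR (- a * (x - y))) *
     (c1 * l1 * expR (l1 * y) + c2 * l2 * expR (l2 * y))) =
  c1 * ((l1 + a) * expR (b * x) + (b - l1) * expR (- a * x)
        - (a + b) * expR (l1 * x)) +
  c2 * ((l2 + a) * expR (b * x) + (b - l2) * expR (- a * x)
        - (a + b) * expR (l2 * x)).
Proof.
move=> x0 k0 l1E l2E.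
pose E p c y := expR (p + c * y).
have dE p c y : is_derive y 1 (E p c) (c * E p c y).
  exact: is_derive_expR_affine.
(* A direct primitive would divide by l - b and l + a. Since k * l = - (l - b) * (l + a),
   multiplying by [k] clears both denominators, so neither factor has to be nonzero. *)
pose H c l := c *: ((l - b) *: E (- a * x) (l + a) - (l + a) *: E (b * x) (l - b)).
pose h c l y := c * ((l - b) * ((l + a) * E (- a * x) (l + a) y)
                     - (l + a) * ((l - b) * E (b * x) (l - b) y)).
have dH c l y : is_derive y 1 (H c l) (h c l y) by apply: is_derive_eq.
have dF y : is_derive y 1 (k^-1 *: (H c1 l1 + H c2 l2))
    (k^-1 * (h c1 l1 y + h c2 l2 y)).
  exact: (is_deriveZ _ (is_deriveD (dH c1 l1 y) (dH c2 l2 y))).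
have cE p c : continuous (E p c).
  move=> y; apply/differentiable_continuous/derivable1_diffP.
  by case: (dE p c y).
have ch c l : continuous (h c l).
  move=> y; apply: cvgM; first exact: cvg_cst.
  by apply: cvgB; (apply: cvgM; first exact: cvg_cst);
    apply: cvgM; [exact: cvg_cst|exact: cE|exact: cvg_cst|exact: cE].
have hE c l y : (l - b) * (l + a) = - (k * l) -> h c l y = k *
    ((expR (b * (x - y)) - expR (- a * (x - y))) * (c * l * expR (l * y))).
  move=> lE.
  have -> : h c l y = c * ((l - b) * (l + a)) *
      (E (- a * x) (l + a) y - E (b * x) (l - b) y) by rewrite /h; ring.
  rewrite lE /E.
  have -> : - a * x + (l + a) * y = - a * (x - y) + l * y by ring.
  have -> : b * x + (l - b) * y = b * (x - y) + l * y by ring.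
  by rewrite !expRD; ring.
under eq_Rintegral => y _.
  rewrite (_ : _ * _ = k^-1 * (h c1 l1 y + h c2 l2 y)); last first.
    by rewrite !hE//; field.
  over.
rewrite (Rintegral_continuous_FTC2 x0 _ dF); last first.
  move=> y; apply: cvgM; first exact: cvg_cst.
  by apply: cvgD; exact: ch.
rewrite !fctE /GRing.scale /= mulrBr !mulVKf// /H !fctE /E /GRing.scale /=.
(* At y = x both exponents collapse to l * x, which yields the - (a + b) * expR (l * x) term; at y =
   0 the exponentials in - a * x and b * x remain. *)
have ea l : - a * x + (l + a) * x = l * x by ring.
have eb l : b * x + (l - b) * x = l * x by ring.
by rewrite !ea !eb !mulr0 !addr0; ring.
Qed.

End refraction.

(** * Roots of the Laplace exponent and closed forms of the scale functions *)

Section scale_functions.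
Context {R : realType}.
Implicit Types (m sigma delta q l x z : R).

Lemma discriminant_gt0 m sigma q : 0 < sigma -> 0 < q ->
  0 < m ^+ 2 + 2 * q * sigma ^+ 2.
Proof.
by move=> s0 q0; rewrite ltr_wpDl ?sqr_ge0// !mulr_gt0// exprn_gt0.
Qed.

Lemma rhoE m sigma q :
  rho m sigma q = 2 * Num.sqrt (m ^+ 2 + 2 * q * sigma ^+ 2) / sigma ^+ 2.
Proof. by rewrite /rho /rho1 /rho2; ring. Qed.

Lemma rho_gt0 m sigma q : 0 < sigma -> 0 < q -> 0 < rho m sigma q.
Proof.
move=> s0 q0.
by rewrite rhoE divr_gt0 ?exprn_gt0// mulr_gt0// sqrtr_gt0 discriminant_gt0.
Qed.

(** The right side is 2 / sigma ^ 2 times psi(l) - q for drift [m], so [rho2] and [- rho1] are its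
    roots. *)
Lemma rho_factor m sigma q l : 0 < sigma -> 0 < q ->
  (l - rho2 m sigma q) * (l + rho1 m sigma q) =
  l ^+ 2 + 2 * m * l / sigma ^+ 2 - 2 * q / sigma ^+ 2.
Proof.
move=> s0 q0; rewrite /rho1 /rho2.
have := sqr_sqrtr (ltW (discriminant_gt0 m s0 q0)).
set S := Num.sqrt _ => SE.
have -> : q = (S ^+ 2 - m ^+ 2) / (2 * sigma ^+ 2).
  by rewrite SE; field; rewrite gt_eqF.
by field; rewrite gt_eqF.
Qed.

Lemma scaleW_ge0E m sigma q x : 0 < sigma -> 0 <= x ->
  scaleW m sigma q x =
  (expR (rho2 m sigma q * x) - expR (- rho1 m sigma q * x)) /
  Num.sqrt (m ^+ 2 + 2 * q * sigma ^+ 2).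
Proof.
move=> s0 x0; rewrite /scaleW ltNge x0 /= rhoE mulrC; congr (_ * _).
set S := Num.sqrt _; have sn0 : sigma != 0 by rewrite gt_eqF.
(* [q] is arbitrary here, so the root may vanish; both sides are then 0 because division by 0 gives
   0. *)
have [->|Sn0] := eqVneq S 0; first by rewrite mulr0 mul0r mulr0 invr0 mulr0.
by field; rewrite Sn0 sn0.
Qed.

Lemma derive1_scaleW m sigma q x : 0 < sigma -> 0 < x ->
  (scaleW m sigma q)^`()%classic x =
  (rho2 m sigma q * expR (rho2 m sigma q * x)
   + rho1 m sigma q * expR (- rho1 m sigma q * x)) /
  Num.sqrt (m ^+ 2 + 2 * q * sigma ^+ 2).
Proof.
move=> s0 x0; rewrite derive1E.
set S := Num.sqrt _; set u := rho2 _ _ _; set v := rho1 _ _ _.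
pose E (c y : R) : R := expR (0 + c * y).
have dE c : is_derive x 1 (E c) (c * E c x) by exact: is_derive_expR_affine.
have dG : is_derive x 1 (S^-1 *: (E u - E (- v)))
    (S^-1 * (u * E u x - - v * E (- v) x)).
  exact: (is_deriveZ _ (is_deriveB (dE u) (dE (- v)))).
(* Near a positive point the case split in [scaleW] is not seen, so the derivative is that of the
   exponential formula. *)
rewrite (@near_eq_derive _ _ _ _ (S^-1 *: (E u - E (- v)))).
  have [_ ->] := dG.
  by rewrite /E !add0r mulNr opprK mulrC.
near=> y.
have y0 : 0 < y by near: y; exact: lt_nbhsr.
by rewrite scaleW_ge0E ?ltW// !fctE /E !add0r /GRing.scale /= mulrC.
Unshelve. all: by end_near. Qed.

(** [G l] is what the convolution leaves of [expR (l * x)] once that term has cancelled. Taking z >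
    0 keeps y + z away from the kink of the scale function. *)
Lemma refracted_w_ge0E m sigma delta q x z :
  0 < sigma -> 0 < delta -> 0 < q -> 0 <= x -> 0 < z ->
  let a := rho1 (m - delta) sigma q in
  let b := rho2 (m - delta) sigma q in
  let G l := ((l + a) * expR (b * x) + (b - l) * expR (- a * x)) /
             rho (m - delta) sigma q in
  refracted_w m sigma delta q x (- z) =
  (G (rho2 m sigma q) * expR (rho2 m sigma q * z)
   - G (- rho1 m sigma q) * expR (- rho1 m sigma q * z)) /
  Num.sqrt (m ^+ 2 + 2 * q * sigma ^+ 2).
Proof.
move=> s0 d0 q0 x0 z0 a b G; rewrite /refracted_w ltNge x0 /= opprK.
have sn0 : sigma != 0 by rewrite gt_eqF.
have dn0 : delta != 0 by rewrite gt_eqF.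
have Sn0 : Num.sqrt (m ^+ 2 + 2 * q * sigma ^+ 2) != 0.
  by rewrite gt_eqF// sqrtr_gt0 discriminant_gt0.
have rhon0 : rho (m - delta) sigma q != 0 by rewrite gt_eqF// rho_gt0.
have abn0 : a + b != 0 by exact: rhon0.
have s2abn0 : sigma ^+ 2 * (a + b) != 0 by rewrite mulf_neq0 ?expf_neq0.
have SYE : Num.sqrt ((m - delta) ^+ 2 + 2 * q * sigma ^+ 2) =
    sigma ^+ 2 / 2 * rho (m - delta) sigma q by rewrite rhoE; field.
rewrite scaleW_ge0E//; last by rewrite addr_ge0// ltW.
set S := Num.sqrt _ in Sn0 *; set u := rho2 m sigma q; set v := rho1 m sigma q.
(* Passing from drift m to m - delta changes the factored quadratic only by - 2 * delta * l / sigma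
   ^ 2, so a root for X satisfies the convolution hypothesis. *)
have root l : (l - u) * (l + v) = 0 ->
    (l - b) * (l + a) = - (2 * delta / sigma ^+ 2 * l).
  rewrite !rho_factor// => lE.
  rewrite -[LHS](subr0) -lE; by field.
have k0 : 2 * delta / sigma ^+ 2 != 0 by rewrite !mulf_neq0 ?invr_eq0 ?expf_neq0.
have uE := root u _; have vE := root (- v) _.
(* The coefficients collect the normalizations of both scale functions: [S] for X, and sigma ^ 2 / 2
   * (a + b), the square root of the discriminant, for Y. *)
have := @refracted_convolution _ a b _ (expR (u * z) / (S * (sigma ^+ 2 / 2 * (a + b)))) u
  (- expR (- v * z) / (S * (sigma ^+ 2 / 2 * (a + b)))) (- v) x x0 k0
  (uE _) (vE _).
rewrite subrr mul0r addNr mulr0 => /(_ erefl erefl).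
under [X in _ + delta * X]eq_Rintegral => y.
  rewrite inE/= in_itv/= => /andP[y0 yx].
  rewrite scaleW_ge0E ?subr_ge0// derive1_scaleW ?ltr_wpDl// SYE -/a -/b -/u -/v -/S.
  rewrite (_ : _ * _ = (expR (b * (x - y)) - expR (- a * (x - y))) *
     (expR (u * z) / (S * (sigma ^+ 2 / 2 * (a + b))) * u * expR (u * y) +
      - expR (- v * z) / (S * (sigma ^+ 2 / 2 * (a + b))) * - v * expR (- v * y))); last first.
    rewrite !mulrDr !expRD -/(rho _ _ _) /rho -/a -/b; field.
    by rewrite -!mulrDr Sn0 (mulf_neq0 Sn0) s2abn0.
  over.
set I := Rintegral _ _ _ => IE.
have -> : delta * I = sigma ^+ 2 / 2 * (2 * delta / sigma ^+ 2 * I) by field.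
rewrite IE /G -/(rho _ _ _) /rho -/a -/b !mulrDr !expRD; field.
by rewrite -!mulrDr Sn0 abn0 (mulf_neq0 Sn0).
Qed.

End scale_functions.

Lemma integral_tilted_lin (R : realType) (nu : {measure set R -> \bar R})
    (a1 l1 a2 l2 zeta J1 J2 : R) : 0 <= zeta ->
  (\int[nu]_(z in `[zeta, +oo[) (expR (l1 * z) * z)%:E = J1%:E)%E ->
  (\int[nu]_(z in `[zeta, +oo[) (expR (l2 * z) * z)%:E = J2%:E)%E ->
  (\int[nu]_(z in `[zeta, +oo[)
    ((a1 * expR (l1 * z) - a2 * expR (l2 * z)) * z)%:E =
    (a1 * J1 - a2 * J2)%:E)%E.
Proof.
move=> zeta0 J1E J2E.
(* On the half-line the integrand is nonnegative, so a finite integral gives integrability, and the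
   signed combination may be split. *)
have int l J (JE :
    (\int[nu]_(z in `[zeta, +oo[) (expR (l * z) * z)%:E = J%:E)%E) :
    nu.-integrable `[zeta, +oo[ (fun z => (expR (l * z) * z)%:E).
  apply/integrableP; split.
    apply/measurable_EFinP; apply: measurable_funM => //.
    by apply: measurableT_comp => //; exact: measurable_funM.
  under eq_integral => z.
    rewrite inE/= in_itv/= andbT => zetaz.
    rewrite /= ger0_norm; last by rewrite mulr_ge0 ?expR_ge0// (le_trans zeta0).
    over.
  by rewrite /= JE ltry.
under eq_integral do rewrite mulrBl EFinB -!mulrA (EFinM a1) (EFinM a2).
rewrite integralB//; last 2 first.
- by apply: integrableZl => //; exact: (int _ _ J1E).
- by apply: integrableZl => //; exact: (int _ _ J2E).
rewrite !integralZl//; last 2 first.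
- exact: (int _ _ J2E).
- exact: (int _ _ J1E).
by rewrite J1E J2E -!EFinM -EFinB.
Qed.

(** * The two branches of V *)

Section parisian_refracted_scale_function.
Context (d : measure_display)
    (T : measurableType d) (R : realType) (P : probability T R)
    (B X : R -> {RV P >-> R}) (mu sigma q r : R).

(** At the two roots the tilted drift is [s] or [- s] and the prefactor is [expR (q * r)] for both.
    The negative drift turns - a2 into + a2 before the second tail. *)
Lemma integral_drifted_bm_rho (a1 a2 zeta : R) :
  standard_brownian_motion B ->
  (forall w, X r w = mu * r + sigma * B r w) ->
  0 < sigma -> 0 < q -> 0 < r -> 0 <= zeta ->
  let s := Num.sqrt (mu ^+ 2 + 2 * q * sigma ^+ 2) in
  (\int[distribution P (X r)]_(z in `[zeta, +oo[)
    ((a1 * expR (rho2 mu sigma q * z) - a2 * expR (- rho1 mu sigma q * z)) / s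
     * (z / r))%:E =
   (expR (q * r) * (a1 * (1 - Phi ((zeta - r * s) / (sigma * Num.sqrt r)))
                    + a2 * (1 - Phi ((zeta + r * s) / (sigma * Num.sqrt r))))
    + sigma / s * (a1 * expR (rho2 mu sigma q * zeta)
                   - a2 * expR (- rho1 mu sigma q * zeta)) *
      normal_pdf 0 (Num.sqrt r) ((zeta - mu * r) / sigma))%:E)%E.
Proof.
move=> hB hX sigma0 q0 r0 zeta0 s.
have sn0 : s != 0 by rewrite gt_eqF// sqrtr_gt0 discriminant_gt0.
have rn0 : r != 0 by rewrite gt_eqF.
have sigman0 : sigma != 0 by rewrite gt_eqF.
have s2E : s ^+ 2 = mu ^+ 2 + 2 * q * sigma ^+ 2.
  by rewrite sqr_sqrtr// ltW// discriminant_gt0.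
(* With [q] expressed through [s], the root identities become rational in [s]. *)
have qE : q = (s ^+ 2 - mu ^+ 2) / (2 * sigma ^+ 2) by rewrite s2E; field.
set u := rho2 mu sigma q; set v := rho1 mu sigma q.
have uE : (mu + u * sigma ^+ 2) * r = r * s by rewrite /u /rho2 -/s; field.
have vE : (mu + - v * sigma ^+ 2) * r = - (r * s).
  by rewrite /v /rho1 -/s; field.
have uqE : (mu * u + sigma ^+ 2 * u ^+ 2 / 2) * r = q * r.
  by rewrite [in RHS]qE /u /rho2 -/s; field.
have vqE : (mu * - v + sigma ^+ 2 * (- v) ^+ 2 / 2) * r = q * r.
  by rewrite [in RHS]qE /v /rho1 -/s; field.
have J l := integral_drifted_bm_tilted l hB hX r0 sigma0 zeta0.
under eq_integral => z _.
  rewrite (_ : _ * (z / r) = (a1 / (s * r) * expR (u * z)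
      - a2 / (s * r) * expR (- v * z)) * z); last by field; rewrite rn0 sn0.
  over.
rewrite /= (integral_tilted_lin _ _ zeta0 (J u) (J (- v))).
rewrite uqE vqE uE vE opprK; congr EFin.
by field; rewrite rn0 sn0.
Qed.

(** W(x + z) vanishes for z < - x, so the integral effectively starts at [- x]. *)
Lemma parisian_V_lt0 (delta x : R) :
  standard_brownian_motion B ->
  (forall w, X r w = mu * r + sigma * B r w) ->
  0 < sigma -> 0 < q -> 0 < r -> x < 0 ->
  let s := Num.sqrt (mu ^+ 2 + 2 * q * sigma ^+ 2) in
  parisian_V (X r) mu sigma delta q r x =
  (expR (q * r) * (expR (rho2 mu sigma q * x) *
      (1 - Phi ((- x - r * s) / (sigma * Num.sqrt r)))
    + expR (- rho1 mu sigma q * x) *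
      (1 - Phi ((- x + r * s) / (sigma * Num.sqrt r)))))%:E.
Proof.
move=> hB hX sigma0 q0 r0 x0 s; set u := rho2 _ _ _; set v := rho1 _ _ _.
have Nx0 : 0 <= - x by rewrite oppr_ge0 ltW.
have := integral_drifted_bm_rho (expR (u * x)) (expR (- v * x)) hB hX
  sigma0 q0 r0 Nx0.
(* The boundary term drops out: at zeta = - x its bracket is 1 - 1, that is, W(0) = 0. *)
rewrite /= -/s -/u -/v -!expRD !mulrN !subrr mulr0 mul0r addr0 => <-.
rewrite /parisian_V integral_mkcond [RHS]integral_mkcond.
apply: eq_integral => z _; rewrite !patchE !mem_setE /= !in_itv /= !andbT.
have [xz|zx] := leP (- x) z.
  rewrite (le_trans Nx0 xz) /refracted_w x0 opprK scaleW_ge0E//; last first.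
    by rewrite -lerBlDl sub0r.
  by rewrite -/u -/v -/s !mulrDr !expRD.
case: ifPn => // z0.
by rewrite /refracted_w x0 /scaleW opprK -ltrBrDl sub0r zx mul0r.
Qed.

(** The boundary term at zeta = 0 contains G(u) - G(- v), which is (u + v) * (e^(b x) - e^(- a x)) /
    (a + b), a multiple of the scale function of Y. The tails give G(u) - (G(u) - G(- v)) * p with p
    the [Phi] value, and G(u) splits into u times sigma ^ 2 / 2 * W_Y(x) plus the last summand of
    the formula. *)
Lemma parisian_V_ge0 (delta x : R) :
  standard_brownian_motion B ->
  (forall w, X r w = mu * r + sigma * B r w) ->
  0 < sigma -> 0 < q -> 0 < delta -> 0 < r -> 0 <= x ->
  let s := Num.sqrt (mu ^+ 2 + 2 * q * sigma ^+ 2) in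
  let a := rho1 (mu - delta) sigma q in
  let b := rho2 (mu - delta) sigma q in
  parisian_V (X r) mu sigma delta q r x =
  (sigma ^+ 2 / 2 * scaleW (mu - delta) sigma q x *
      (2 / Num.sqrt (2 * pi * sigma ^+ 2 * r) *
         expR (- (r * mu ^+ 2 / (2 * sigma ^+ 2)))
       + rho2 mu sigma q * expR (q * r)
       - rho mu sigma q * expR (q * r) *
         Phi (- r * s / (sigma * Num.sqrt r)))
    + expR (q * r) / rho (mu - delta) sigma q *
      (a * expR (b * x) + b * expR (- a * x)))%:E.
Proof.
move=> hB hX sigma0 q0 delta0 r0 x0 s a b.
set u := rho2 mu sigma q; set v := rho1 mu sigma q.
have sn0 : s != 0 by rewrite gt_eqF// sqrtr_gt0 discriminant_gt0.
have rn0 : r != 0 by rewrite gt_eqF.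
have sigman0 : sigma != 0 by rewrite gt_eqF.
have abn0 : a + b != 0 by rewrite gt_eqF//; exact: rho_gt0.
pose G l := ((l + a) * expR (b * x) + (b - l) * expR (- a * x)) /
            rho (mu - delta) sigma q.
transitivity (\int[distribution P (X r)]_(z in `[0%R, +oo[)
    ((G u * expR (u * z) - G (- v) * expR (- v * z)) / s * (z / r))%:E)%E.
  apply: eq_integral => z; rewrite inE/= in_itv/= andbT le_eqVlt.
  case/predU1P => [<-|z0]; first by rewrite !mul0r !mulr0.
  by rewrite refracted_w_ge0E.
rewrite integral_drifted_bm_rho//= -/s !mulr0 expR0 !mulr1 !sub0r add0r.
have pdfE : normal_pdf 0 (Num.sqrt r) (- mu * r / sigma) =
    sigma / Num.sqrt (2 * pi * sigma ^+ 2 * r) *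
    expR (- (r * mu ^+ 2 / (2 * sigma ^+ 2))).
  rewrite normal_pdfE ?gt_eqF ?sqrtr_gt0// /normal_peak /normal_fun.
  rewrite subr0 sqr_sqrtr ?ltW//; congr (_ * expR _); last first.
    by field; rewrite sigman0 rn0.
  rewrite (_ : 2 * pi * sigma ^+ 2 * r = sigma ^+ 2 * (r * pi *+ 2)); last by ring.
  by rewrite sqrtrM ?sqr_ge0// sqrtr_sqr gtr0_norm// invfM mulVKf.
have sE : s = sigma ^+ 2 / 2 * (u + v).
  by rewrite -[u + v]addrC -/(rho mu sigma q) rhoE -/s; field.
have uvn0 : u + v != 0.
  by rewrite addrC gt_eqF//; exact: rho_gt0.
have SYE : Num.sqrt ((mu - delta) ^+ 2 + 2 * q * sigma ^+ 2) =
    sigma ^+ 2 / 2 * (a + b).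
  by rewrite -/(rho (mu - delta) sigma q) rhoE; field.
rewrite -[- (mu * r)]mulNr -[- (r * s)]mulNr pdfE scaleW_ge0E// SYE -/a -/b -/s.
(* Reflection expresses both tails through the same value of [Phi]. *)
have -> : 1 - Phi (r * s / (sigma * Num.sqrt r)) =
    Phi (- r * s / (sigma * Num.sqrt r)) by rewrite -PhiN !mulNr.
rewrite /G.
rewrite -[rho mu sigma q]/(v + u) -[rho (mu - delta) sigma q]/(a + b).
set p := Phi (- r * s / _); set N := (Num.sqrt _)^-1; rewrite sE; congr EFin.
by field; rewrite sigman0 abn0 uvn0.
Qed.
End parisian_refracted_scale_function.

Theorem proposition12 (d : measure_display) (T : measurableType d)
    (R : realType) (P : probability T R) (B X : R -> {RV P >-> R})
    (mu sigma delta q r : R)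
    (hB : standard_brownian_motion B)
    (hX : forall (t : R) (w : T), 0 <= t -> X t w = mu * t + sigma * B t w)
    (hsigma : 0 < sigma) (hq : 0 < q) (hdelta : 0 < delta) (hr : 0 < r) :
  let V := parisian_V (X r) mu sigma delta q r in
  let s := Num.sqrt (mu ^+ 2 + 2 * q * sigma ^+ 2) in
  let rho1X := rho1 mu sigma q in
  let rho2X := rho2 mu sigma q in
  let rhoX := rho mu sigma q in
  let rho1Y := rho1 (mu - delta) sigma q in
  let rho2Y := rho2 (mu - delta) sigma q in
  let rhoY := rho (mu - delta) sigma q in
  (forall x : R, 0 <= x ->
     V x =
     (sigma ^+ 2 / 2 * scaleW (mu - delta) sigma q x *
        (2 / Num.sqrt (2 * pi * sigma ^+ 2 * r) *
           expR (- (r * mu ^+ 2 / (2 * sigma ^+ 2)))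
         + rho2X * expR (q * r)
         - rhoX * expR (q * r) * Phi (- r * s / (sigma * Num.sqrt r)))
      + expR (q * r) / rhoY *
        (rho1Y * expR (rho2Y * x) + rho2Y * expR (- rho1Y * x)))%:E) /\
  (forall x : R, x < 0 ->
     V x =
     (expR (q * r) *
        (expR (rho2X * x) * (1 - Phi ((- x - r * s) / (sigma * Num.sqrt r)))
         + expR (- rho1X * x) *
           (1 - Phi ((- x + r * s) / (sigma * Num.sqrt r)))))%:E).
Proof.
move=> V s rho1X rho2X rhoX rho1Y rho2Y rhoY.
have hXr w : X r w = mu * r + sigma * B r w by apply: hX; exact: ltW.
split=> x x0.
- exact: (parisian_V_ge0 hB hXr).
- exact: (parisian_V_lt0 delta hB hXr).
Qed.
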